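(* Consider nearest-center assignment in $\mathbb{R}^2$ with the two fixed centers $c_1=(-1,0)$ and $c_2=(1,0)$. For any $\varepsilon>0$, there exist a configuration $X\in(\mathbb{R}^2)^n$ with $n\ge3$ and a perturbation $X'\in(\mathbb{R}^2)^n$ with $\|X-X'\|\le\varepsilon$ such that at least one index changes its assigned center, and the induced partitions differ: $A(X')\ne A(X)$.
   Context: $\|\cdot\|$ on $\mathbb{R}^2$ is the Euclidean norm; configurations are ordered tuples $X=(x_1,\dots,x_n)$, $X'=(x_1',\dots,x_n')$, and $\|X-X'\|=\max_{1\le i\le n}\|x_i-x_i'\|$. Nearest-center assignment with a deterministic tie-breaking rule: a fixed function $\ell:\mathbb{R}^2\to\{1,2\}$ with $\|x-c_{\ell(x)}\|\le\|x-c_j\|$ for all $x$ and $j=1,2$; the point $x$ is assigned to $c_{\ell(x)}$. The induced partition $A(X)$ of $[n]=\{1,\dots,n\}$ is the one in which $i,j$ lie in the same block if and only if $\ell(x_i)=\ell(x_j)$. Index $i$ changes its assigned center if $\ell(x_i')\ne\ell(x_i)$. *)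

(* Defs.v *)
From mathcomp Require Import all_boot all_order all_algebra.
From mathcomp Require Import reals.

Set Implicit Arguments.
Unset Strict Implicit.
Unset Printing Implicit Defensive.

Import Order.TTheory GRing.Theory Num.Theory.
Local Open Scope ring_scope.

(* The norm that MathComp-Analysis puts on row vectors is the sup norm, hence
   an explicit Euclidean norm. *)
Definition enorm (R : realType) (d : nat) (x : 'rV[R]_d) : R :=
  Num.sqrt (\sum_(i < d) x 0 i ^+ 2).

Definition config (R : realType) (n : nat) := 'I_n -> 'rV[R]_2.

(* The default value 0 of the iterated maximum is harmless: distances are
   nonnegative. *)
Definition config_dist (R : realType) (n : nat) (X X' : config R n) : R :=
  \big[Num.max/0]_(i < n) enorm (X i - X' i).

(* An arbitrary function l choosing, for each point, the label of one of its
   nearest centers; ties are broken by l itself. *)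
Definition nearest_center_assignment (R : realType) (k : nat)
    (c : 'I_k -> 'rV[R]_2) (l : 'rV[R]_2 -> 'I_k) : Prop :=
  forall (x : 'rV[R]_2) (j : 'I_k), enorm (x - c (l x)) <= enorm (x - c j).

Definition induced_partition (R : realType) (k n : nat)
    (l : 'rV[R]_2 -> 'I_k) (X : config R n) : {set {set 'I_n}} :=
  preim_partition (fun i : 'I_n => l (X i)) [set: 'I_n].

Definition point (R : realType) (a b : R) : 'rV[R]_2 :=
  \row_(i < 2) (if i == 0 then a else b).

(* Labels are numbered from 0: the centers c_1 and c_2 have labels 0 and 1. *)
Definition two_centers (R : realType) (j : 'I_2) : 'rV[R]_2 :=
  if j == 0 then point (-1) 0 else point 1 0.

(* Main.v *)
Require Import Defs.
From mathcomp Require Import all_boot all_order all_algebra.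
From mathcomp Require Import reals.
From mathcomp Require Import lra.

Import Order.TTheory GRing.Theory Num.Theory.
Local Open Scope ring_scope.

(** The assignment is discontinuous across the perpendicular bisector of the
    two centers, the line of abscissa [0]: the squared distances from [(a, b)]
    to them differ by [4a], so the sign of [a] alone decides the label, however
    small [a] is, as long as it is nonzero ([label_neg], [label_pos]).
    A point can thus be carried across the bisector by a move of length [eps],
    from [(- eps / 2, 0)] to [(eps / 2, 0)]. A relabelled point need not change
    the partition, since the two blocks could merely trade names; keeping
    another point fixed at the center [(1, 0)] excludes this, because the moving
    point joins the block of that anchor. *)

Lemma enorm_pointB (R : realType) (a b c d : R) :
  enorm (point a b - point c d) = Num.sqrt ((a - c) ^+ 2 + (b - d) ^+ 2).
Proof. by rewrite /enorm big_ord_recl big_ord1 !mxE. Qed.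

Lemma label_neg (R : realType) (l : 'rV[R]_2 -> 'I_2) (a b : R) :
  nearest_center_assignment (@two_centers R) l -> a < 0 ->
  l (point a b) = 0.
Proof.
move=> /(_ (point a b) 0) hl a_lt0; apply/eqP; apply: contraTT hl => l_neq0.
rewrite /two_centers (negPf l_neq0) eqxx !enorm_pointB -ltNge ltr_sqrt; nra.
Qed.

Lemma label_pos (R : realType) (l : 'rV[R]_2 -> 'I_2) (a b : R) :
  nearest_center_assignment (@two_centers R) l -> 0 < a ->
  l (point a b) = 1.
Proof.
move=> /(_ (point a b) 1) hl a_gt0.
have l_neq0 : l (point a b) != 0.
  apply: contraTneq hl => ->.
  rewrite /two_centers eqxx /= !enorm_pointB -ltNge ltr_sqrt; nra.
by apply: val_inj; case: (l _) l_neq0 => [[|[|]]].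
Qed.

(** Partitions are told apart by the equivalence relations they induce. *)
Lemma mem_pblock_induced_partition (R : realType) (k n : nat)
    (l : 'rV[R]_2 -> 'I_k) (X : config R n) (i j : 'I_n) :
  (j \in pblock (induced_partition l X) i) = (l (X i) == l (X j)).
Proof.
rewrite pblock_equivalence_partition ?inE //.
by split=> // /eqP ->.
Qed.

(** The iterated maximum starts from [0], hence the first hypothesis. *)
Lemma config_dist_le (R : realType) (n : nat) (X X' : config R n) (e : R) :
  0 <= e -> (forall i, enorm (X i - X' i) <= e) -> config_dist X X' <= e.
Proof.
move=> e_ge0 le_e; apply: (big_ind (fun m => m <= e)) => // x y xe ye.
by rewrite ge_max xe.
Qed.

(** A moving point of abscissa [t], together with one anchor at each center. *)
Definition anchored_config {R : realType} (t : R) : config R 3 :=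
  fun i => if i == 0 then point t 0
           else if i == 1 then point 1 0 else point (-1) 0.

Lemma config_dist_anchored {R : realType} (s t : R) :
  config_dist (anchored_config s) (anchored_config t) <= `|s - t|.
Proof.
apply: config_dist_le => // i; rewrite /anchored_config.
by do 2?[case: ifP => _]; rewrite enorm_pointB !subrr ?expr0n ?addr0 ?sqrtr0
  ?sqrtr_sqr.
Qed.

Theorem proposition6p2 (R : realType) (l : 'rV[R]_2 -> 'I_2)
    (hl : nearest_center_assignment (@two_centers R) l)
    (eps : R) (heps : 0 < eps) :
  exists (n : nat) (X X' : config R n),
    [/\ (3 <= n)%N,
        config_dist X X' <= eps,
        exists i : 'I_n, l (X' i) <> l (X i)
      & induced_partition l X' <> induced_partition l X].
Proof.
have before : l (point (- (eps / 2)) 0) = 0 by apply: label_neg hl _; lra.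
have after : l (point (eps / 2) 0) = 1 by apply: label_pos hl _; lra.
have anchor : l (point 1 0) = 1 by apply: label_pos hl _; lra.
exists 3%N, (anchored_config (- (eps / 2))), (anchored_config (eps / 2)).
split=> //.
- apply: le_trans (config_dist_anchored _ _) _.
  by rewrite ler_norml; apply/andP; split; lra.
- by exists 0; rewrite /anchored_config eqxx before after.
- move=> /(congr1 (fun P => 1 \in pblock P 0)).
  by rewrite !mem_pblock_induced_partition /anchored_config /= before after
    anchor.
Qed.
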